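(* Let $\pi:M(c)\to N$ be an anti-invariant submersion from a quaternionic space form $(M(c),g_M)$ onto a Riemannian manifold $(N,g_N)$. Let $p\in M(c)$ and let $\{U_1,\dots,U_r,X_1,\dots,X_\ell\}$ be an orthonormal frame of $T_pM(c)$ such that $\mathcal V_p=\mathrm{span}\{U_1,\dots,U_r\}$ and $\mathcal H_p=\mathrm{span}\{X_1,\dots,X_\ell\}$. Then $$\widehat{Ric}(U_1)\ \ge\ \frac c4(r-1)-\frac14 r^2\|H\|^2 .$$ Equality holds if and only if, for all $s=1,\dots,\ell$, $$\mathcal T_{11}^s=\mathcal T_{22}^s+\cdots+\mathcal T_{rr}^s\quad\text{and}\quad \mathcal T_{1j}^s=0\ \ (j=2,\dots,r).$$
   Context: An almost quaternionic Hermitian manifold $(M,E,g_M)$ is a $4m$-dimensional Riemannian manifold with a rank 3 subbundle $E\subset \mathrm{End}(TM)$ having, near each point, a local basis $\{J_1,J_2,J_3\}$ of sections with $J_\alpha^2=-\mathrm{id}$, $J_\alpha J_{\alpha+1}=-J_{\alpha+1}J_\alpha=J_{\alpha+2}$ (indices mod 3) and $g_M(J_\alpha X,J_\alpha Y)=g_M(X,Y)$. It is quaternionic Kähler if there are local 1-forms $\omega_1,\omega_2,\omega_3$ with $\nabla_XJ_\alpha=\omega_{\alpha+2}(X)J_{\alpha+1}-\omega_{\alpha+1}(X)J_{\alpha+2}$, $\nabla$ the Levi-Civita connection. A quaternionic space form $M(c)$ ($c\in\mathbb R$) is a quaternionic Kähler manifold whose curvature tensor is $$R(X,Y)Z=\tfrac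 c4\Big\{g_M(Y,Z)X-g_M(X,Z)Y+\sum_{\alpha=1}^3\big(g_M(J_\alpha Y,Z)J_\alpha X-g_M(J_\alpha X,Z)J_\alpha Y+2g_M(J_\alpha Y,X)J_\alpha Z\big)\Big\}.$$ A Riemannian submersion $\pi:(M,g_M)\to(N,g_N)$ ($\dim M>\dim N$) is a smooth surjective map of maximal rank whose differential restricted to $(\ker\pi_* )^\perp$ is a linear isometry. Write $\mathcal V=\ker\pi_*$ (vertical), $\mathcal H=(\ker\pi_* )^\perp$ (horizontal), and use the same letters for the orthogonal projections. The submersion $\pi$ is anti-invariant if $J_\alpha(\ker\pi_* )\subset(\ker\pi_* )^\perp$ for $\alpha=1,2,3$. O'Neill tensor: $\mathcal T_EF=\mathcal H\nabla_{\mathcal VE}\mathcal VF+\mathcal V\nabla_{\mathcal VE}\mathcal HF$. Write $\mathcal T_{ij}^s=g_M(\mathcal T_{U_i}U_j,X_s)$ for $1\le i,j\le r$, $1\le s\le\ell$. The mean curvature vector of the fibers is $H=\frac1r\sum_{j=1}^r\mathcal T_{U_j}U_j$. Curvature convention: $R(X,Y,Z,W)=g_M(R(X,Y)Z,W)$, and the curvature tensor $\hat R$ of the vertical distribution (fibers) is related to $R$ by $$R(U,V,F,W)=\hat R(U,V,F,W)+g_M(\mathcal T_UW,\mathcal T_VF)-g_M(\mathcal T_VW,\mathcal T_UF)$$ for vertical $U,V,F,W$; the sign of the curvature tensors is the one for which this holds, i.e. $R(X,Y)Z=\nabla_{[X,Y]}Z-\nabla_X\nabla_YZ+\nabla_Y\nabla_XZ$.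 Finally $\widehat{Ric}(U)=\sum_{i=1}^r\hat R(U,U_i,U_i,U)$. *)

(* Defs.v *)
From HB Require Import structures.
From mathcomp Require Import all_boot all_order all_algebra.
From mathcomp Require Import all_classical all_reals all_analysis.

Set Implicit Arguments.
Unset Strict Implicit.
Unset Printing Implicit Defensive.

Import Order.TTheory GRing.Theory Num.Theory.
Import numFieldNormedType.Exports.

Local Open Scope classical_set_scope.
Local Open Scope ring_scope.

(* Conventions.  Tangent vectors at a point are represented, in a chart, by
   their row of components, and the tangent space in that chart is 'rV_n.
   Linear maps act on the right: the differential of f at x sends u to
   u *m 'J f x, and an endomorphism A sends u to u *m A, so that the
   composite "A after B" is the matrix B *m A.  A tensor field on a manifold is
   a family of component functions, one for each chart, related by the usual
   transformation rule; values outside the image of the chart are junk. *)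

Fixpoint diff_upto (R : realType) (n : nat) (W : normedModType R) (k : nat)
    (D : set 'rV[R]_n) (f : 'rV[R]_n -> W) : Prop :=
  if k is k'.+1 then
    (forall x, D x -> differentiable f x) /\
    (forall v : 'rV[R]_n, diff_upto k' D (fun x => 'D_v f x))
  else True.

Definition smooth_on (R : realType) (n : nat) (W : normedModType R)
    (D : set 'rV[R]_n) (f : 'rV[R]_n -> W) : Prop :=
  forall k, diff_upto k D f.

(* [chart_coord i] is only meaningful on [chart_dom i], and [chart_param i], its
   inverse, only on the image of [chart_dom i]. *)
Record smooth_manifold (R : realType) (n : nat) := SmoothManifold {
  manifold_points :> topologicalType;
  points_hausdorff : hausdorff_space manifold_points;
  points_second_countable : @second_countable manifold_points;
  chart : Type;
  chart_dom : chart -> set manifold_points;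
  chart_coord : chart -> manifold_points -> 'rV[R]_n;
  chart_param : chart -> 'rV[R]_n -> manifold_points;
  dom_open : forall i, open (chart_dom i);
  dom_cover : forall p, exists i, chart_dom i p;
  image_open : forall i, open (chart_coord i @` chart_dom i);
  coordK : forall i p, chart_dom i p -> chart_param i (chart_coord i p) = p;
  coord_continuous : forall i p, chart_dom i p ->
    {for p, continuous (chart_coord i)};
  param_continuous : forall i x, (chart_coord i @` chart_dom i) x ->
    {for x, continuous (chart_param i)};
  transition_smooth : forall i j,
    smooth_on (chart_coord i @` (chart_dom i `&` chart_dom j))
              (chart_coord j \o chart_param i) }.

Definition chart_image (R : realType) (n : nat) (M : smooth_manifold R n)
  (i : chart M) : set 'rV[R]_n := chart_coord i @` chart_dom i.

Definition transition_jac (R : realType) (n : nat) (M : smooth_manifold R n)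
  (i j : chart M) (p : M) : 'M[R]_n :=
  'J (chart_coord j \o chart_param i) (chart_coord i p).

Definition inner (R : realType) (n : nat) (G : 'M[R]_n) (u v : 'rV[R]_n) : R :=
  (u *m G *m v^T) 0 0.

Record riemannian_metric (R : realType) (n : nat) (M : smooth_manifold R n) :=
  RiemannianMetric {
  metric :> chart M -> 'rV[R]_n -> 'M[R]_n;
  metric_smooth : forall i, smooth_on (chart_image i) (metric i);
  metric_sym : forall i x, chart_image i x -> (metric i x)^T = metric i x;
  metric_pos : forall i x (u : 'rV[R]_n), chart_image i x -> u != 0 ->
    0 < inner (metric i x) u u;
  metric_change : forall i j (p : M) (u v : 'rV[R]_n),
    chart_dom i p -> chart_dom j p ->
    inner (metric i (chart_coord i p)) u v =
    inner (metric j (chart_coord j p))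
      (u *m transition_jac i j p) (v *m transition_jac i j p) }.

(* Gamma^k_ij = 1/2 sum_l g^kl (d_i g_jl + d_j g_il - d_l g_ij) *)
Definition christoffel (R : realType) (n : nat) (g : 'rV[R]_n -> 'M[R]_n)
    (x : 'rV[R]_n) (k i j : 'I_n) : R :=
  let d (a : 'I_n) : 'M[R]_n := 'D_(delta_mx 0 a) g x in
  2^-1 * \sum_(l < n) invmx (g x) k l * (d i j l + d j i l - d l i j).

(* The Levi-Civita connection of the metric whose components in a chart are g;
   X and Y are the components of vector fields in that chart. *)
Definition nabla (R : realType) (n : nat) (g : 'rV[R]_n -> 'M[R]_n)
    (X Y : 'rV[R]_n -> 'rV[R]_n) (x : 'rV[R]_n) : 'rV[R]_n :=
  'D_(X x) Y x +
  \row_k \sum_(i < n) \sum_(j < n) christoffel g x k i j * X x 0 i * Y x 0 j.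

Definition lie_bracket (R : realType) (n : nat)
    (X Y : 'rV[R]_n -> 'rV[R]_n) (x : 'rV[R]_n) : 'rV[R]_n :=
  'D_(X x) Y x - 'D_(Y x) X x.

(* Beware of the sign: this is minus the more common convention. *)
Definition curvature (R : realType) (n : nat)
    (D : ('rV[R]_n -> 'rV[R]_n) -> ('rV[R]_n -> 'rV[R]_n) ->
         'rV[R]_n -> 'rV[R]_n)
    (X Y Z : 'rV[R]_n -> 'rV[R]_n) (x : 'rV[R]_n) : 'rV[R]_n :=
  D (lie_bracket X Y) Z x - D X (D Y Z) x + D Y (D X Z) x.

(* Indices are in 'I_3, whose addition is modulo 3. *)
Definition hermitian_quaternionic (R : realType) (n : nat) (G : 'M[R]_n)
    (J : 'I_3 -> 'M[R]_n) : Prop :=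
  forall a : 'I_3,
    [/\ J a *m J a = - 1%:M,
        J (a + 1) *m J a = J (a + 2),
        J a *m J (a + 1) = - J (a + 2)
      & forall u v, inner G (u *m J a) (v *m J a) = inner G u v].

Definition local_basis (R : realType) (n : nat) (D : set 'rV[R]_n)
    (g : 'rV[R]_n -> 'M[R]_n) (E : 'rV[R]_n -> set 'M[R]_n)
    (W : set 'rV[R]_n) (J : 'I_3 -> 'rV[R]_n -> 'M[R]_n) : Prop :=
  [/\ open W, W `<=` D,
      forall a, smooth_on W (J a)
    & forall x, W x -> hermitian_quaternionic (g x) (J ^~ x) /\
        E x = [set A | exists a : 'I_3 -> R, A = \sum_(b < 3) a b *: J b x]].

(* The rank 3 subbundle E of End(TM).  Matrices A and B represent the same
   endomorphism of T_pM in the charts i and j iff they are intertwined by the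
   Jacobian of the transition map.  The rank is 3 because matrices satisfying
   the quaternionic relations are linearly independent. *)
Record almost_quaternionic_hermitian (R : realType) (n : nat)
    (M : smooth_manifold R n) (g : riemannian_metric M) :=
  AlmostQuaternionicHermitian {
  bundle :> chart M -> 'rV[R]_n -> set 'M[R]_n;
  bundle_change : forall i j (p : M) (A B : 'M[R]_n),
    chart_dom i p -> chart_dom j p ->
    A *m transition_jac i j p = transition_jac i j p *m B ->
    (bundle i (chart_coord i p) A <-> bundle j (chart_coord j p) B);
  bundle_basis : forall i x, chart_image i x ->
    exists W J, W x /\ local_basis (chart_image i) (g i) (bundle i) W J }.

(* The value at X of the 1-form omega a is (X *m omega a) 0 0. *)
Definition quaternionic_kahler (R : realType) (n : nat)
    (M : smooth_manifold R n) (g : riemannian_metric M)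
    (E : almost_quaternionic_hermitian g) : Prop :=
  forall (i : chart M) W J, local_basis (chart_image i) (g i) (E i) W J ->
  exists omega : 'I_3 -> 'rV[R]_n -> 'cV[R]_n,
    (forall a, smooth_on W (omega a)) /\
    forall (a : 'I_3) (X Y : 'rV[R]_n -> 'rV[R]_n) x,
      smooth_on W X -> smooth_on W Y -> W x ->
      nabla (g i) X (fun y => Y y *m J a y) x - nabla (g i) X Y x *m J a x =
      (X x *m omega (a + 2) x) 0 0 *: (Y x *m J (a + 1) x) -
      (X x *m omega (a + 1) x) 0 0 *: (Y x *m J (a + 2) x).

Definition space_form_curvature (R : realType) (n : nat) (c : R) (G : 'M[R]_n)
    (J : 'I_3 -> 'M[R]_n) (X Y Z : 'rV[R]_n) : 'rV[R]_n :=
  (c / 4) *: (inner G Y Z *: X - inner G X Z *: Y +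
    \sum_(a < 3) (inner G (Y *m J a) Z *: (X *m J a)
                  - inner G (X *m J a) Z *: (Y *m J a)
                  + (2 * inner G (Y *m J a) X) *: (Z *m J a))).

Definition quaternionic_space_form (R : realType) (n : nat)
    (M : smooth_manifold R n) (g : riemannian_metric M)
    (E : almost_quaternionic_hermitian g) (c : R) : Prop :=
  quaternionic_kahler E /\
  forall (i : chart M) W J, local_basis (chart_image i) (g i) (E i) W J ->
  forall (X Y Z : 'rV[R]_n -> 'rV[R]_n) x,
    smooth_on W X -> smooth_on W Y -> smooth_on W Z -> W x ->
    curvature (nabla (g i)) X Y Z x =
    space_form_curvature c (g i x) (J ^~ x) (X x) (Y x) (Z x).

(* Subspaces of the tangent space are row spaces.  For f the expression in
   charts of a submersion, [vert f x] is the kernel of its differential at x,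
   and [horiz g f x] the orthogonal complement of the latter. *)
Definition vert (R : realType) (n l : nat) (f : 'rV[R]_n -> 'rV[R]_l)
  (x : 'rV[R]_n) : 'M[R]_n := kermx ('J f x).

Definition horiz (R : realType) (n l : nat) (g : 'rV[R]_n -> 'M[R]_n)
  (f : 'rV[R]_n -> 'rV[R]_l) (x : 'rV[R]_n) : 'M[R]_n :=
  kermx (g x *m (vert f x)^T).

Definition vpart (R : realType) (n l : nat) (g : 'rV[R]_n -> 'M[R]_n)
    (f : 'rV[R]_n -> 'rV[R]_l) (F : 'rV[R]_n -> 'rV[R]_n)
    (x : 'rV[R]_n) : 'rV[R]_n :=
  F x *m proj_mx (vert f x) (horiz g f x).

Definition hpart (R : realType) (n l : nat) (g : 'rV[R]_n -> 'M[R]_n)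
    (f : 'rV[R]_n -> 'rV[R]_l) (F : 'rV[R]_n -> 'rV[R]_n)
    (x : 'rV[R]_n) : 'rV[R]_n :=
  F x *m proj_mx (horiz g f x) (vert f x).

(* The value of the O'Neill tensor on the tangent vectors u, v at x: since it
   is a tensor, u and v can be extended by constant components. *)
Definition oneill_T (R : realType) (n l : nat) (g : 'rV[R]_n -> 'M[R]_n)
    (f : 'rV[R]_n -> 'rV[R]_l) (x u v : 'rV[R]_n) : 'rV[R]_n :=
  let E := fun _ : 'rV[R]_n => u in
  let F := fun _ : 'rV[R]_n => v in
  hpart g f (nabla g (vpart g f E) (vpart g f F)) x +
  vpart g f (nabla g (vpart g f E) (hpart g f F)) x.

(* The Levi-Civita connection of the fibers, on vertical vector fields. *)
Definition nabla_hat (R : realType) (n l : nat) (g : 'rV[R]_n -> 'M[R]_n)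
    (f : 'rV[R]_n -> 'rV[R]_l) (X Y : 'rV[R]_n -> 'rV[R]_n) :
    'rV[R]_n -> 'rV[R]_n :=
  vpart g f (nabla g X Y).

(* The vertical vectors u, v, w at x are extended to the vertical vector fields
   [vpart g f (cst _)]; the result is tensorial, hence independent of this
   choice. *)
Definition curvature_hat (R : realType) (n l : nat) (g : 'rV[R]_n -> 'M[R]_n)
    (f : 'rV[R]_n -> 'rV[R]_l) (x u v w : 'rV[R]_n) : 'rV[R]_n :=
  curvature (nabla_hat g f) (vpart g f (cst u)) (vpart g f (cst v))
    (vpart g f (cst w)) x.

(* The rows of U are meant to be an orthonormal basis of the vertical space. *)
Definition ricci_hat (R : realType) (n l r : nat) (g : 'rV[R]_n -> 'M[R]_n)
    (f : 'rV[R]_n -> 'rV[R]_l) (x : 'rV[R]_n) (U : 'M[R]_(r, n))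
    (u : 'rV[R]_n) : R :=
  \sum_(a < r) inner (g x) (curvature_hat g f x u (row a U) (row a U)) u.

Definition mean_curvature (R : realType) (n l r : nat)
    (g : 'rV[R]_n -> 'M[R]_n) (f : 'rV[R]_n -> 'rV[R]_l) (x : 'rV[R]_n)
    (U : 'M[R]_(r, n)) : 'rV[R]_n :=
  r%:R^-1 *: \sum_(a < r) oneill_T g f x (row a U) (row a U).

Definition in_charts (R : realType) (n l : nat) (M : smooth_manifold R n)
    (N : smooth_manifold R l) (phi : M -> N) (i : chart M) (j : chart N) :
    'rV[R]_n -> 'rV[R]_l :=
  chart_coord j \o phi \o chart_param i.

Definition smooth_map (R : realType) (n l : nat) (M : smooth_manifold R n)
    (N : smooth_manifold R l) (phi : M -> N) : Prop :=
  continuous phi /\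
  forall i j,
    smooth_on (chart_coord i @` (chart_dom i `&` phi @^-1` chart_dom j))
              (in_charts phi i j).

Definition riemannian_submersion (R : realType) (n l : nat)
    (M : smooth_manifold R n) (gM : riemannian_metric M)
    (N : smooth_manifold R l) (gN : riemannian_metric N)
    (phi : M -> N) : Prop :=
  [/\ (l < n)%N, smooth_map phi, forall q, exists p, phi p = q
    & forall (i : chart M) (j : chart N) (p : M),
      chart_dom i p -> chart_dom j (phi p) ->
      let f := in_charts phi i j in
      let x := chart_coord i p in
      \rank ('J f x) = l /\
      forall u v : 'rV[R]_n,
        (u <= horiz (gM i) f x)%MS -> (v <= horiz (gM i) f x)%MS ->
        inner (gN j (chart_coord j (phi p))) (u *m 'J f x) (v *m 'J f x) =
        inner (gM i x) u v].

Definition anti_invariant (R : realType) (n l : nat)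
    (M : smooth_manifold R n) (gM : riemannian_metric M)
    (E : almost_quaternionic_hermitian gM)
    (N : smooth_manifold R l) (phi : M -> N) : Prop :=
  forall (i : chart M) (j : chart N) (p : M),
  chart_dom i p -> chart_dom j (phi p) ->
  let f := in_charts phi i j in
  let x := chart_coord i p in
  forall W J, local_basis (chart_image i) (gM i) (E i) W J -> W x ->
  forall a : 'I_3, (vert f x *m J a x <= horiz (gM i) f x)%MS.

(* Main.v *)
Require Import Defs.
From HB Require Import structures.
From mathcomp Require Import all_boot all_order all_algebra.
From mathcomp Require Import all_classical all_reals all_analysis.
From mathcomp Require Import ring.

(** The inequality comes from the Gauss equation of the fibers.  Write T_ab for
    the O'Neill tensor on the vertical frame vectors U_a, U_b.  With the sign
    convention in force, the Gauss equation ([gauss_fiber]) evaluated on the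
    frame reads
      Rhat(U_1, U_a, U_a, U_1) =
        R(U_1, U_a, U_a, U_1) - <T_aa, T_11> + <T_1a, T_a1>.
    Since every J_k maps vertical vectors to horizontal ones, the quaternionic
    terms of the curvature of a space form vanish on vertical vectors, so that
    the first term is c/4 for a <> 1 ([space_form_sectional]).  Brackets
    of vertical fields are vertical, so T is symmetric ([oneill_TC]), and T_ab is
    horizontal ([oneill_T_horiz]), so that the inner products expand over the
    frame X_s ([parseval]).  Summing over a and completing the square, with
    r H = sum_a T_aa,
      Ric(U_1) - (c/4 (r - 1) - 1/4 r^2 |H|^2) =
        sum_s (1/4 (T_11^s - sum_(a <> 1) T_aa^s)^2 + sum_(a <> 1) (T_1a^s)^2)
    ([gapE]).  The right-hand side is a sum of squares, which gives the
    inequality and, when it vanishes, the equality case.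

    The Gauss equation itself is proved for the row spaces of any smooth field
    P of orthogonal projections: the Levi-Civita connection followed by P has,
    up to the second fundamental forms, the same curvature as the Levi-Civita
    connection, because the normal part 1 - P of a derivative can be moved to
    the other factor by metric compatibility ([nabla_orthogonal]).  For the
    vertical distribution of a submersion f with Jacobian A, the projection is
      1 - A (A^T g^-1 A)^-1 A^T g^-1,
    which is smooth because A and g are.  Integrability of this distribution is
    the symmetry of the second derivative of f ([derive_comm]). *)

Set Implicit Arguments.
Unset Strict Implicit.
Unset Printing Implicit Defensive.

Import Order.TTheory GRing.Theory Num.Theory.
Import numFieldNormedType.Exports.

Local Open Scope classical_set_scope.
Local Open Scope ring_scope.

(** * Smooth functions on an open set *)

Section Smooth.
Context {R : realType} {n : nat}.
Implicit Types (W : normedModType R) (D : set 'rV[R]_n).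

Lemma open_near_eq W D (f g : 'rV[R]_n -> W) x :
  open D -> {in D, f =1 g} -> D x -> {near x, f =1 g}.
Proof.
move=> oD fg Dx; rewrite /prop_near1; near=> y; apply: fg; apply/mem_set.
by near: y; apply: open_nbhs_nbhs.
Unshelve. all: by end_near. Qed.

Lemma near_eq_diff W (f g : 'rV[R]_n -> W) x :
  {near x, f =1 g} -> differentiable f x -> differentiable g x.
Proof.
move=> fg /diff_locallyP[cf df].
have fgx : f x = g x := nbhs_singleton fg.
have h : g \o shift x = cst (g x) + 'd f x +o_ 0 id.
  apply/eqaddoP => e e0.
  have /eqaddoP/(_ e e0) := df.
  have fg0 : \forall h \near 0, f (h + x) = g (h + x).
    have : \forall y \near x, f y = g y by [].
    by rewrite (near_shift 0 x) /= subr0.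
  apply: filterS2 fg0 => h /= E.
  by rewrite !fctE /= E fgx.
have dd := diff_unique cf h.
by apply/diff_locallyP; rewrite dd.
Qed.

Lemma diff_upto_ext W D k (f g : 'rV[R]_n -> W) :
  open D -> {in D, f =1 g} -> diff_upto k D f -> diff_upto k D g.
Proof.
move=> oD; elim: k f g => //= k IH f g fg [df kf]; split.
  by move=> x Dx; apply: near_eq_diff (df x Dx); apply: open_near_eq fg Dx.
move=> v; apply: IH (kf v) => x /set_mem Dx.
by apply: near_eq_derive; apply: open_near_eq fg Dx.
Qed.

Lemma diff_uptoW W D k (f : 'rV[R]_n -> W) :
  diff_upto k.+1 D f -> diff_upto k D f.
Proof.
elim: k f => //= k IH f [df kf]; split => // v.
by apply: IH; apply: kf.
Qed.

Lemma smooth_ext W D (f g : 'rV[R]_n -> W) :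
  open D -> {in D, f =1 g} -> smooth_on D f -> smooth_on D g.
Proof. by move=> oD fg sf k; apply: diff_upto_ext (sf k). Qed.

Lemma smooth_subset W D D' (f : 'rV[R]_n -> W) :
  D' `<=` D -> smooth_on D f -> smooth_on D' f.
Proof.
move=> sD sf k; elim: k f sf => //= k IH f sf; split.
  by move=> x /sD Dx; have [+ _] := sf 1%N; apply.
by move=> v; apply: IH => k'; have [_] := sf k'.+1; apply.
Qed.

Lemma smooth_diff W D (f : 'rV[R]_n -> W) x :
  smooth_on D f -> D x -> differentiable f x.
Proof. by move=> sf Dx; have [+ _] := sf 1%N; apply. Qed.

Lemma smooth_derive W D (f : 'rV[R]_n -> W) v :
  smooth_on D f -> smooth_on D ('D_v f).
Proof. by move=> sf k; have [_] := sf k.+1; apply. Qed.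

Lemma smooth_cst W D (w : W) : smooth_on D (cst w).
Proof.
move=> k; elim: k w => //= k IH w; split=> // v.
have -> : (fun x : 'rV[R]_n => 'D_v (cst w) x) = cst 0; last exact: IH.
by apply/funext => x; rewrite derive_cst.
Qed.

Lemma diff_uptoD W D k (f g : 'rV[R]_n -> W) : open D ->
  diff_upto k D f -> diff_upto k D g -> diff_upto k D (fun x => f x + g x).
Proof.
move=> oD; elim: k f g => //= k IH f g [df kf] [dg kg]; split.
  by move=> x Dx; apply: differentiableD; [apply: df | apply: dg].
move=> v; apply: diff_upto_ext (IH _ _ (kf v) (kg v)) => //.
move=> x /set_mem Dx; apply/esym/deriveD; apply: diff_derivable; first exact: df.
exact: dg.
Qed.

Lemma smoothD W D (f g : 'rV[R]_n -> W) : open D ->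
  smooth_on D f -> smooth_on D g -> smooth_on D (fun x => f x + g x).
Proof. by move=> oD sf sg k; apply: diff_uptoD. Qed.

Lemma smooth_sum W D m (f : 'I_m -> 'rV[R]_n -> W) : open D ->
  (forall i, smooth_on D (f i)) -> smooth_on D (fun x => \sum_i f i x).
Proof.
move=> oD sf.
have -> : (fun x => \sum_i f i x) = \sum_i f i.
  by apply/funext => x; rewrite fct_sumE.
elim/big_ind: _ => [|g h sg sh|i _] //; [exact: smooth_cst | exact: smoothD].
Qed.

(** The induction has to carry the bound k on the order, rather than smoothness
    itself: Leibniz expresses the derivative by products of functions that are
    differentiable one time less. *)
Lemma diff_uptoM D k (f g : 'rV[R]_n -> R) : open D ->
  diff_upto k D f -> diff_upto k D g -> diff_upto k D (fun x => f x * g x).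
Proof.
move=> oD; elim: k f g => //= k IH f g [df kf] [dg kg].
have wf : diff_upto k D f by apply: diff_uptoW; split.
have wg : diff_upto k D g by apply: diff_uptoW; split.
split; first by move=> x Dx; apply: differentiableM; [apply: df | apply: dg].
move=> v; apply: diff_upto_ext (diff_uptoD oD (IH _ _ wf (kg v))
  (IH _ _ wg (kf v))) => // x /set_mem Dx.
rewrite deriveM //; apply: diff_derivable; [exact: df | exact: dg].
Qed.

Lemma smoothM D (f g : 'rV[R]_n -> R) : open D ->
  smooth_on D f -> smooth_on D g -> smooth_on D (fun x => f x * g x).
Proof. by move=> oD sf sg k; apply: diff_uptoM. Qed.

Lemma smoothB W D (f h : 'rV[R]_n -> W) : open D ->
  smooth_on D f -> smooth_on D h -> smooth_on D (fun x => f x - h x).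
Proof.
move=> oD sf sh; apply: smoothD => // k; elim: k h sh => //= k IH h sh; split.
  by move=> x Dx; apply: differentiableN; apply: smooth_diff Dx.
move=> v; apply: diff_upto_ext (IH _ (smooth_derive v sh)) => // x /set_mem Dx.
by apply/esym/deriveN/diff_derivable; apply: smooth_diff Dx.
Qed.

(** The derivative of 1/f is -(1/f)^2 f', so order k + 1 for 1/f follows from
    order k for 1/f and for f'. *)
Lemma smoothV D (f : 'rV[R]_n -> R) : open D -> (forall x, D x -> f x != 0) ->
  smooth_on D f -> smooth_on D (fun x => (f x)^-1).
Proof.
move=> oD f0 sf; elim=> //= k IH; split.
  by move=> x Dx; apply: differentiableV (f0 x Dx); apply: smooth_diff Dx.
move=> v; have := diff_uptoM oD (smooth_cst D (-1 : R) k)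
  (diff_uptoM oD (diff_uptoM oD IH IH) (smooth_derive v sf k)).
apply: diff_upto_ext => // x /set_mem Dx /=.
rewrite deriveV ?f0 //; last by apply: diff_derivable; apply: smooth_diff Dx.
by rewrite /cst mulN1r -invfM -expr2 scaleNr.
Qed.

Lemma diff_uptoZl W D k (f : 'rV[R]_n -> R) (w : W) : open D ->
  diff_upto k D f -> diff_upto k D (fun x => f x *: w).
Proof.
move=> oD; elim: k f => //= k IH f [df kf]; split.
  by move=> x Dx; apply: differentiableZl; apply: df.
move=> v; apply: diff_upto_ext (IH _ (kf v)) => // x /set_mem Dx /=.
rewrite !deriveE ?diffZl //; last exact: df.
  exact: df.
by apply: differentiableZl; apply: df.
Qed.

Lemma smoothZl W D (f : 'rV[R]_n -> R) (w : W) : open D ->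
  smooth_on D f -> smooth_on D (fun x => f x *: w).
Proof. by move=> oD sf k; apply: diff_uptoZl. Qed.

Lemma diff_entry p q (A : 'rV[R]_n -> 'M[R]_(p, q)) x i j :
  differentiable A x -> differentiable (fun y => A y i j : R) x.
Proof.
move=> dA; pose e (N : 'M[R]_(p, q)) := N i j : R.
exact: (@differentiable_comp _ _ _ _ A e x dA (differentiable_coord _ i j)).
Qed.

Lemma derive_entry p q (A : 'rV[R]_n -> 'M[R]_(p, q)) x v i j :
  differentiable A x -> 'D_v (fun y => A y i j : R) x = 'D_v A x i j.
Proof. by move=> dA; rewrite derive_mx ?mxE //; apply: diff_derivable. Qed.

Lemma differentiable_mx p q (A : 'rV[R]_n -> 'M[R]_(p, q)) x :
  (forall i j, differentiable (fun y => A y i j : R) x) -> differentiable A x.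
Proof.
move=> dA; have -> : A = \sum_i \sum_j fun y => A y i j *: delta_mx i j.
  apply/funext => y; rewrite fct_sumE [LHS]matrix_sum_delta.
  by apply: eq_bigr => i _; rewrite fct_sumE.
by do 2![apply: differentiable_sum => ?]; apply: differentiableZl.
Qed.

(** Reduces smoothness of matrix-valued functions to the scalar case. *)
Lemma smooth_mxP p q D (A : 'rV[R]_n -> 'M[R]_(p, q)) : open D ->
  smooth_on D A <-> forall i j, smooth_on D (fun x => A x i j : R).
Proof.
move=> oD; split=> [sA i j k|sA].
  elim: k A sA => //= k IH A sA; split.
    by move=> x Dx; apply: diff_entry; apply: smooth_diff Dx.
  move=> v; apply: diff_upto_ext (IH _ (smooth_derive v sA)) => //.
  by move=> x /set_mem Dx; rewrite derive_entry //; apply: smooth_diff Dx.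
apply: (smooth_ext (f := fun x => \sum_i \sum_j A x i j *: delta_mx i j)) => //.
  by move=> x _; rewrite -matrix_sum_delta.
by apply: smooth_sum => // i; apply: smooth_sum => // j; apply: smoothZl.
Qed.

Lemma smooth_trmx p q D (A : 'rV[R]_n -> 'M[R]_(p, q)) : open D ->
  smooth_on D A -> smooth_on D (fun x => (A x)^T).
Proof.
move=> oD /smooth_mxP sA; apply/smooth_mxP => // i j.
by apply: smooth_ext (sA oD j i) => // x _; rewrite mxE.
Qed.

Lemma smooth_mulmx p q r D (A : 'rV[R]_n -> 'M[R]_(p, q))
    (B : 'rV[R]_n -> 'M[R]_(q, r)) : open D ->
  smooth_on D A -> smooth_on D B -> smooth_on D (fun x => A x *m B x).
Proof.
move=> oD /smooth_mxP sA /smooth_mxP sB; apply/smooth_mxP => // i j.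
apply: (smooth_ext (f := fun x => \sum_k A x i k * B x k j)) => //.
  by move=> x _; rewrite mxE.
by apply: smooth_sum => // k; apply: smoothM; [|apply: sA|apply: sB].
Qed.

(** Laplace expansion, by induction on the size. *)
Lemma smooth_cofactor q D (A : 'rV[R]_n -> 'M[R]_q.+1) a b : open D ->
  smooth_on D A -> smooth_on D (fun x => cofactor (A x) a b).
Proof.
rewrite /cofactor => oD sA; apply: smoothM => //; first exact: smooth_cst.
elim: q A a b sA => [|q IH] A a b sA.
  by apply: smooth_ext (smooth_cst D (1 : R)) => // x _; rewrite det_mx00.
apply: (smooth_ext (f := fun x => \sum_j row' a (col' b (A x)) 0 j *
    ((-1) ^+ (0%N + j) * \det (row' 0 (col' j (row' a (col' b (A x)))))))) => //.
  by move=> x _; rewrite (expand_det_row _ 0).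
have s' : smooth_on D (fun x => row' a (col' b (A x))).
  apply/smooth_mxP => // i j.
  move/smooth_mxP: sA => /(_ oD (lift a i) (lift b j)).
  by apply: smooth_ext => // x _; rewrite !mxE.
apply: smooth_sum => // j; apply: smoothM => //.
  by move/smooth_mxP: s'; apply.
by apply: smoothM => //; [exact: smooth_cst | exact: IH].
Qed.

Lemma smooth_invmx q D (A : 'rV[R]_n -> 'M[R]_q) : open D ->
  (forall x, D x -> A x \in unitmx) ->
  smooth_on D A -> smooth_on D (fun x => invmx (A x)).
Proof.
case: q A => [|q] A oD uA sA; apply/smooth_mxP => //; first by case.
move=> i j; have sdet : smooth_on D (fun x => \det (A x)).
  apply: (smooth_ext (f := fun x => \sum_j A x 0 j * cofactor (A x) 0 j)) => //.
    by move=> x _; rewrite (expand_det_row _ 0).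
  apply: smooth_sum => // k; apply: smoothM => //; last exact: smooth_cofactor.
  by move/smooth_mxP: sA; apply.
apply: (smooth_ext (f := fun x => (\det (A x))^-1 * cofactor (A x) j i)) => //.
  by move=> x /set_mem Dx; rewrite /invmx uA // !mxE.
apply: smoothM (smooth_cofactor _ _ oD sA) => //; apply: smoothV => // x Dx.
by have := uA x Dx; rewrite unitmxE unitfE.
Qed.

Lemma derive_mulmx p q r (A : 'rV[R]_n -> 'M[R]_(p, q))
    (B : 'rV[R]_n -> 'M[R]_(q, r)) x v :
  differentiable A x -> differentiable B x ->
  'D_v (fun y => A y *m B y) x = 'D_v A x *m B x + A x *m 'D_v B x.
Proof.
move=> dA dB.
have E i j : (fun y => (A y *m B y) i j) =
    \sum_k (fun y => A y i k : R) * (fun y => B y k j : R).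
  by apply/funext => y; rewrite mxE fct_sumE.
have dM i k j : derivable ((fun y => A y i k : R) * (fun y => B y k j : R)) x v.
  by apply/diff_derivable/differentiableM; apply: diff_entry.
rewrite derive_mx; last first.
  by apply/derivable_mxP => i j; rewrite E; apply: derivable_sum.
apply/matrixP => i j; rewrite !mxE E derive_sum // -big_split /=.
apply: eq_bigr => k _; rewrite deriveM; first last.
- by apply/diff_derivable/diff_entry.
- by apply/diff_derivable/diff_entry.
by rewrite !derive_entry // addrC /GRing.scale /= [B x k j * _]mulrC.
Qed.

Lemma differentiable_mulmx p q r (A : 'rV[R]_n -> 'M[R]_(p, q))
    (B : 'rV[R]_n -> 'M[R]_(q, r)) x :
  differentiable A x -> differentiable B x ->
  differentiable (fun y => A y *m B y) x.
Proof.
move=> dA dB.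
apply: differentiable_mx => i j.
have -> : (fun y => (A y *m B y) i j) =
    \sum_k (fun y => A y i k : R) * (fun y => B y k j : R).
  by apply/funext => y; rewrite mxE fct_sumE.
apply: differentiable_sum => k.
by apply: differentiableM; apply: diff_entry.
Qed.

Lemma differentiable_trmx p q (A : 'rV[R]_n -> 'M[R]_(p, q)) x :
  differentiable A x -> differentiable (fun y => (A y)^T) x.
Proof.
move=> dA; apply: differentiable_mx => i j.
have -> : (fun y => (A y)^T i j) = (fun y => A y j i).
  by apply/funext => y; rewrite mxE.
exact: diff_entry.
Qed.

Lemma derive_trmx p q (A : 'rV[R]_n -> 'M[R]_(p, q)) x v :
  differentiable A x -> 'D_v (fun y => (A y)^T) x = ('D_v A x)^T.
Proof.
move=> dA; apply/matrixP => i j; rewrite [RHS]mxE.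
have E : (fun y => (A y)^T i j) = (fun y => A y j i).
  by apply/funext => y; rewrite mxE.
have <- := derive_entry v j i dA; rewrite -E.
exact: (esym (derive_entry v i j (differentiable_trmx dA))).
Qed.

Lemma derive_sum_coord W (f : 'rV[R]_n -> W) x v : differentiable f x ->
  'D_v f x = \sum_a v 0 a *: 'D_(delta_mx 0 a) f x.
Proof.
move=> df; rewrite deriveE // {1}[v]row_sum_delta linear_sum.
by apply: eq_bigr => a _; rewrite linearZ deriveE.
Qed.

Lemma jacobianE l (f : 'rV[R]_n -> 'rV[R]_l) x a b : differentiable f x ->
  'J f x a b = 'D_(delta_mx 0 a) f x 0 b.
Proof. by move=> df; rewrite deriveE // /jacobian mxE. Qed.

Lemma smooth_jacobian l D (f : 'rV[R]_n -> 'rV[R]_l) : open D ->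
  smooth_on D f -> smooth_on D (fun x => 'J f x).
Proof.
move=> oD sf; apply/smooth_mxP => // a b.
have /smooth_mxP/(_ 0 b) := smooth_derive (delta_mx 0 a) sf.
move/(_ oD); apply: smooth_ext => // x /set_mem Dx.
by rewrite jacobianE //; apply: smooth_diff Dx.
Qed.

End Smooth.

(** * Symmetry of second derivatives *)

Local Opaque derive.

Section Schwarz.
Context {R : realType} {n : nat}.
Implicit Types (D : set 'rV[R]_n) (f : 'rV[R]_n -> R).

Lemma is_derive_line f (y v : 'rV[R]_n) (t : R) :
  differentiable f (y + t *: v) ->
  is_derive t (1 : R) (fun s : R => f (y + s *: v)) ('D_v f (y + t *: v)).
Proof.
move=> df.
have dl : is_diff t (fun s : R => y + s *: v) ( *:%R ^~ v).
  exact: is_diff_eq (is_diffD (is_diff_cst y t) (is_diff_scalel t v)) (add0r _).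
have dc : is_diff t (fun s : R => f (y + s *: v)) ('d f (y + t *: v) \o ( *:%R ^~ v)).
  exact: (is_diff_comp dl (differentiableP df)).
apply: DeriveDef; first by apply: diff_derivable; apply: ex_diff.
by rewrite deriveE ?diff_val /= ?scale1r ?deriveE //; apply: ex_diff.
Qed.

(** The mean value theorem along u for s |-> f(x + su + hv) - f(x + su), then
    along v for 'D_u f.  The left-hand side is symmetric in u and v, which is
    what makes the two mixed derivatives agree in the limit. *)
Lemma second_difference f (x u v : 'rV[R]_n) (h : R) : 0 < h ->
  (forall s t, 0 <= s <= h -> 0 <= t <= h ->
     differentiable f (x + s *: u + t *: v) /\
     differentiable ('D_u f) (x + s *: u + t *: v)) ->
  exists s t, [/\ 0 <= s <= h, 0 <= t <= h &
    f (x + h *: u + h *: v) - f (x + h *: u) - (f (x + h *: v) - f x) =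
    'D_v ('D_u f) (x + s *: u + t *: v) * h * h].
Proof.
move=> h0 df.
have hh : 0 <= h <= h by rewrite ltW /=.
have h00 : (0 : R) <= 0 <= h by rewrite lexx ltW.
pose dF_ (s : R) := 'D_u f ((x + h *: v) + s *: u) - 'D_u f (x + s *: u).
pose F (s : R) := f ((x + h *: v) + s *: u) - f (x + s *: u).
have dF s : 0 <= s <= h -> is_derive s (1 : R) F (dF_ s).
  move=> sh; apply: is_deriveB; apply: is_derive_line.
    by rewrite addrAC; have [] := df _ _ sh hh.
  by have [+ _] := df _ _ sh h00; rewrite scale0r addr0.
have [||s sh Es] := MVT (f := F) (df := dF_) h0.
- by move=> s /itvP sh; apply: dF; rewrite !sh.
- by apply: derivable_within_continuous => s; rewrite in_itv /= => /dF [].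
have {}sh : 0 <= s <= h by rewrite !(itvP sh).
pose dG_ (t : R) := 'D_v ('D_u f) (x + s *: u + t *: v).
pose G (t : R) := 'D_u f ((x + s *: u) + t *: v).
have dG t : 0 <= t <= h -> is_derive t (1 : R) G (dG_ t).
  by move=> th; apply: is_derive_line; have [] := df _ _ sh th.
have [||t th Et] := MVT (f := G) (df := dG_) h0.
- by move=> t /itvP th; apply: dG; rewrite !th.
- by apply: derivable_within_continuous => t; rewrite in_itv /= => /dG [].
have {}th : 0 <= t <= h by rewrite !(itvP th).
exists s, t; split => //.
move: Es Et; rewrite /F /dF_ /G /dG_ !scale0r !addr0 !subr0 => Es Et.
by rewrite -Et [x + h *: u + h *: v]addrAC Es [x + s *: u + h *: v]addrAC.
Qed.

(** Both mixed derivatives are continuous, and on every small parallelogram each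
    takes somewhere the value (second difference) / h^2. *)
Lemma derive_comm_scalar D f (u v x : 'rV[R]_n) : open D -> smooth_on D f ->
  D x -> 'D_v ('D_u f) x = 'D_u ('D_v f) x.
Proof.
move=> oD sf Dx.
have cont (a b : 'rV[R]_n) : {for x, continuous ('D_a ('D_b f))}.
  apply: differentiable_continuous; apply: smooth_diff Dx.
  by do 2![apply: smooth_derive].
suff close e : 0 < e -> `|'D_v ('D_u f) x - 'D_u ('D_v f) x| <= e.
  apply/eqP; rewrite -subr_eq0 -normr_le0; apply/ler_addgt0Pl => e /close.
  by rewrite [e + 0]addr0.
move=> e0; have e2 : 0 < e / 2 by rewrite divr_gt0.
have nA : \forall y \near x, D y /\
    (`|'D_v ('D_u f) x - 'D_v ('D_u f) y| < e / 2 /\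
     `|'D_u ('D_v f) x - 'D_u ('D_v f) y| < e / 2).
  have /cvgrPdist_lt/(_ _ e2) cA := cont v u.
  have /cvgrPdist_lt/(_ _ e2) cB := cont u v.
  have nD : \forall y \near x, D y by apply: open_nbhs_nbhs.
  exact: (filterI nD (filterI cA cB)).
move/nbhs_ballP: nA => [r r0 rA]; have {}r0 : 0 < r by [].
(* This size keeps the parallelogram inside the ball of radius r. *)
pose h := r / 2 / (`|u| + `|v| + 1).
have k0 : 0 < `|u| + `|v| + 1 by rewrite ltr_wpDl // addr_ge0.
have h0 : 0 < h by rewrite !divr_gt0.
have hA s t : 0 <= s <= h -> 0 <= t <= h -> ball x r (x + s *: u + t *: v).
  move=> /andP[s0 sh] /andP[t0 th].
  rewrite -ball_normE /= -addrA opprD addrA subrr add0r normrN.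
  apply: le_lt_trans (ler_normD _ _) _; rewrite !normrZ !ger0_norm //.
  apply: (@le_lt_trans _ _ (h * (`|u| + `|v| + 1))); last first.
    by rewrite /h divfK ?gt_eqF // ltr_pdivrMr // ltr_pMr // ltr1n.
  rewrite !mulrDr mulr1 -[X in X <= _]addr0 lerD ?(ltW h0) //.
  by rewrite lerD // ler_wpM2r.
have [||s [t [sh th E1]]] := @second_difference f x u v h.
- exact: h0.
- move=> s t sh th; have [Dy _] := rA _ (hA _ _ sh th).
  by split; apply: smooth_diff Dy => //; apply: smooth_derive.
have [||s' [t' [sh' th' E2]]] := @second_difference f x v u h.
- exact: h0.
- move=> a b ah bh; rewrite addrAC; have [Dy _] := rA _ (hA _ _ bh ah).
  by split; apply: smooth_diff Dy => //; apply: smooth_derive.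
have [_ [B1 _]] := rA _ (hA _ _ sh th).
have [_ [_ B2]] := rA _ (hA _ _ th' sh').
rewrite [x + t' *: u + s' *: v]addrAC in B2.
rewrite [x + h *: v + h *: u]addrAC in E2.
have squeeze (A B a b k1 k2 k3 k4 : R) :
    k1 - k2 - (k3 - k4) = a * h * h -> k1 - k3 - (k2 - k4) = b * h * h ->
    `|A - a| < e / 2 -> `|B - b| < e / 2 -> `|A - B| <= e.
  move=> Ea Eb Aa Bb; have hI : injective ( *%R^~ h) by apply: mulIf; rewrite gt_eqF.
  have ab : a = b by apply: (hI); apply: (hI); rewrite -Ea -Eb; ring.
  rewrite -ab in Bb; rewrite -(subrKA a) (splitr e).
  by apply: le_trans (ler_normD _ _) _; rewrite lerD ?ltW // distrC.
exact: squeeze E1 E2 B1 B2.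
Qed.

Lemma derive_comm l D (f : 'rV[R]_n -> 'rV[R]_l) (u v x : 'rV[R]_n) :
  open D -> smooth_on D f -> D x -> 'D_v ('D_u f) x = 'D_u ('D_v f) x.
Proof.
move=> oD sf Dx; apply/matrixP => i j.
have sfij : smooth_on D (fun y => f y i j : R) by move/smooth_mxP: sf; apply.
have E (a b : 'rV[R]_n) : 'D_a ('D_b f) x i j = 'D_a ('D_b (fun y => f y i j : R)) x.
  rewrite -derive_entry; last by apply: smooth_diff Dx; apply: smooth_derive.
  apply: near_eq_derive; apply: open_near_eq oD _ Dx => y /set_mem Dy.
  by rewrite derive_entry //; apply: smooth_diff Dy.
exact: (etrans (E v u) (etrans (derive_comm_scalar u v oD sfij Dx) (esym (E u v)))).
Qed.
End Schwarz.

(** * Inner products and the Levi-Civita connection *)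

Section Inner.
Context {R : realType} {n : nat}.
Implicit Types (G : 'M[R]_n) (u v w : 'rV[R]_n).

Definition spd G := G^T = G /\ forall u, u != 0 -> 0 < inner G u u.

Lemma innerDl G u v w : inner G (u + v) w = inner G u w + inner G v w.
Proof. by rewrite /inner !mulmxDl mxE. Qed.

Lemma innerNl G u w : inner G (- u) w = - inner G u w.
Proof. by rewrite /inner !mulNmx mxE. Qed.

Lemma innerBl G u v w : inner G (u - v) w = inner G u w - inner G v w.
Proof. by rewrite innerDl innerNl. Qed.

Lemma innerZl G a u w : inner G (a *: u) w = a * inner G u w.
Proof. by rewrite /inner -!scalemxAl mxE. Qed.

Lemma inner_suml G (I : finType) (F : I -> 'rV[R]_n) w :
  inner G (\sum_i F i) w = \sum_i inner G (F i) w.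
Proof. by rewrite /inner !mulmx_suml summxE. Qed.

Lemma innerDr G u v w : inner G w (u + v) = inner G w u + inner G w v.
Proof. by rewrite /inner linearD mulmxDr mxE. Qed.

Lemma innerNr G u w : inner G w (- u) = - inner G w u.
Proof. by rewrite /inner (linearN (trmx : _ -> _)) mulmxN mxE. Qed.

Lemma innerBr G u v w : inner G w (u - v) = inner G w u - inner G w v.
Proof. by rewrite innerDr innerNr. Qed.

Lemma inner0l G w : inner G 0 w = 0.
Proof. by rewrite /inner !mul0mx mxE. Qed.

Lemma innerM G u v : inner G u v = (u *m G *m v^T) 0 0.
Proof. by []. Qed.

Lemma innerE G u v : inner G u v = \sum_i \sum_j u 0 i * G i j * v 0 j.
Proof.
rewrite /inner mxE exchange_big; apply: eq_bigr => j _.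
by rewrite !mxE mulr_suml.
Qed.

Lemma innerC G u v : G^T = G -> inner G u v = inner G v u.
Proof.
move=> sG; rewrite /inner.
have -> : (u *m G *m v^T) 0 0 = (u *m G *m v^T)^T 0 0 by rewrite [RHS]mxE.
by rewrite !trmx_mul trmxK sG mulmxA.
Qed.

Lemma spd_unitmx G : spd G -> G \in unitmx.
Proof.
move=> [_ pG]; rewrite -row_free_unit -kermx_eq0; apply/rowV0P => u /sub_kermxP uG.
by apply/eqP/negP => /negP /pG; rewrite /inner uG mul0mx mxE ltxx.
Qed.

Lemma spd_inner_eq0 G u : spd G -> (inner G u u == 0) = (u == 0).
Proof.
move=> [_ pG]; apply/idP/eqP => [|->]; last by rewrite inner0l.
by move=> /eqP u0; apply/eqP/negP => /negP /pG; rewrite u0 ltxx.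
Qed.

Lemma inner_eq G u v : spd G -> (forall w, inner G u w = inner G v w) -> u = v.
Proof.
move=> sG E; apply/eqP; rewrite -subr_eq0 -(spd_inner_eq0 _ sG).
by rewrite innerBl E subrr.
Qed.

End Inner.

Local Opaque inner.

Section Connection.
Context {R : realType} {n : nat}.
Implicit Types (g : 'rV[R]_n -> 'M[R]_n) (u v w x : 'rV[R]_n).

(** The order zero part of the Levi-Civita connection, bilinear in the vectors. *)
Definition gamma g x u v : 'rV[R]_n :=
  \row_k \sum_(i < n) \sum_(j < n) christoffel g x k i j * u 0 i * v 0 j.

Lemma nablaE g X Y x : nabla g X Y x = 'D_(X x) Y x + gamma g x (X x) (Y x).
Proof. by []. Qed.

Lemma inner_derive_coord g x u v w : differentiable g x ->
  inner ('D_u g x) v w = \sum_i \sum_j \sum_k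
    'D_(delta_mx 0 i) g x j k * u 0 i * v 0 j * w 0 k.
Proof.
move=> dg; rewrite (derive_sum_coord _ dg).
rewrite innerE; under eq_bigr => j _.
  under eq_bigr => k _.
    rewrite summxE mulr_sumr mulr_suml.
    over.
  rewrite exchange_big; over.
rewrite exchange_big; apply: eq_bigr => i _; apply: eq_bigr => j _.
by apply: eq_bigr => k _; rewrite mxE; ring.
Qed.

(** Koszul's formula: pairing with w cancels the inverse metric in the
    Christoffel symbols. *)
Lemma inner_gamma g x u v w : spd (g x) -> differentiable g x ->
  inner (g x) (gamma g x u v) w =
  2^-1 * (inner ('D_u g x) v w + inner ('D_v g x) u w - inner ('D_w g x) u v).
Proof.
move=> sg dg; pose d i := 'D_(delta_mx 0 i) g x.
pose h : 'rV[R]_n := \row_k (2^-1 * \sum_i \sum_j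
   (d i j k + d j i k - d k i j) * u 0 i * v 0 j).
have -> : gamma g x u v = h *m (invmx (g x))^T.
  apply/rowP => k; rewrite !mxE; under [RHS]eq_bigr => l _.
    rewrite !mxE mulr_sumr mulr_suml; under eq_bigr => i _.
      rewrite mulr_sumr mulr_suml; over.
    over.
  rewrite [RHS]exchange_big; apply: eq_bigr => i _.
  rewrite [RHS]exchange_big; apply: eq_bigr => j _.
  rewrite /christoffel mulr_sumr !mulr_suml; apply: eq_bigr => l _.
  by rewrite /d; ring.
have -> : inner (g x) (h *m (invmx (g x))^T) w = (h *m w^T) 0 0.
  by rewrite innerM trmx_inv sg.1 -(mulmxA h) mulVmx ?spd_unitmx // mulmx1.
have Eu : inner ('D_u g x) v w = \sum_i \sum_j \sum_k
    d i j k * u 0 i * v 0 j * w 0 k by rewrite inner_derive_coord.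
have Ev : inner ('D_v g x) u w = \sum_i \sum_j \sum_k
    d j i k * u 0 i * v 0 j * w 0 k.
  rewrite inner_derive_coord // exchange_big; apply: eq_bigr => i _.
  by apply: eq_bigr => j _; apply: eq_bigr => k _; rewrite /d; ring.
have Ew : inner ('D_w g x) u v = \sum_i \sum_j \sum_k
    d k i j * u 0 i * v 0 j * w 0 k.
  rewrite inner_derive_coord // exchange_big; apply: eq_bigr => i _.
  rewrite exchange_big; apply: eq_bigr => j _; apply: eq_bigr => k _.
  by rewrite /d; ring.
rewrite Eu Ev Ew mxE.
under eq_bigr => k _ do rewrite !mxE -mulrA mulr_suml.
rewrite -mulr_sumr; congr (_ * _); rewrite exchange_big.
under eq_bigr => i _ do under eq_bigr => k _ do rewrite mulr_suml.
under eq_bigr => i _ do rewrite exchange_big.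
rewrite -sumrN -!big_split; apply: eq_bigr => i _ /=.
rewrite -sumrN -!big_split; apply: eq_bigr => j _ /=.
rewrite -sumrN -!big_split; apply: eq_bigr => k _ /=; ring.
Qed.

Lemma derive_sym D g u x : open D -> (forall y, D y -> (g y)^T = g y) ->
  D x -> differentiable g x -> ('D_u g x)^T = 'D_u g x.
Proof.
move=> oD sg Dx dg; rewrite -derive_trmx //.
by apply: near_eq_derive; apply: open_near_eq oD _ Dx => y /set_mem /sg.
Qed.

(** Metric compatibility: in the sum of the two Koszul formulas only the
    derivative along u survives. *)
Lemma gamma_metric D g (u a b x : 'rV[R]_n) :
  open D -> (forall y, D y -> spd (g y)) -> D x -> differentiable g x ->
  inner (g x) (gamma g x u a) b + inner (g x) a (gamma g x u b) =
  inner ('D_u g x) a b.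
Proof.
move=> oD sg Dx dg; have sgx := sg x Dx.
have sD := derive_sym u oD (fun y Dy => (sg y Dy).1) Dx dg.
rewrite [X in _ + X](innerC _ _ sgx.1).
rewrite (inner_gamma u a b sgx dg) (inner_gamma u b a sgx dg) (innerC b a sD).
have half (p q r : R) : 2^-1 * (p + q - r) + 2^-1 * (p + r - q) = p by field.
exact: half.
Qed.

Lemma derive_inner D g (A B : 'rV[R]_n -> 'rV[R]_n) u x :
  open D -> (forall y, D y -> spd (g y)) -> D x ->
  differentiable g x -> differentiable A x -> differentiable B x ->
  'D_u (fun y => inner (g y) (A y) (B y)) x =
  inner (g x) ('D_u A x + gamma g x u (A x)) (B x) +
  inner (g x) (A x) ('D_u B x + gamma g x u (B x)).
Proof.
move=> oD sg Dx dg dA dB.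
have dBT := differentiable_trmx dB.
have dAg : differentiable (fun y => A y *m g y) x by apply: differentiable_mulmx.
have -> : (fun y => inner (g y) (A y) (B y)) =
    (fun y => (A y *m g y *m (B y)^T) 0 0) by apply/funext => y; rewrite innerM.
rewrite derive_entry; last exact: differentiable_mulmx.
rewrite derive_mulmx // derive_mulmx // derive_trmx // mulmxDl.
rewrite innerDl innerDr !innerM.
have E := gamma_metric u (A x) (B x) oD sg Dx dg; rewrite !innerM in E.
have add (M1 M2 M3 : 'M[R]_1) (a b c d e : R) : M1 0 0 = a -> M2 0 0 = c ->
    M3 0 0 = d -> b + e = c -> (M1 + M2 + M3) 0 0 = a + b + (d + e).
  by move=> <- M2c <- be; rewrite 2!mxE M2c -be; ring.
exact: add E.
Qed.

(** The connection is torsion free. *)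
Lemma gammaC D g u v x : open D -> (forall y, D y -> spd (g y)) -> D x ->
  differentiable g x -> gamma g x u v = gamma g x v u.
Proof.
move=> oD sg Dx dg; have sgx := sg x Dx; apply: (inner_eq sgx) => w.
have sD := derive_sym w oD (fun y Dy => (sg y Dy).1) Dx dg.
rewrite (inner_gamma u v w sgx dg) (inner_gamma v u w sgx dg) (innerC u v sD).
have swap (p q r : R) : 2^-1 * (p + q - r) = 2^-1 * (q + p - r).
  by rewrite [p + q]addrC.
exact: swap.
Qed.

Lemma smooth_gamma D g (X Y : 'rV[R]_n -> 'rV[R]_n) : open D ->
  (forall y, D y -> spd (g y)) -> smooth_on D g -> smooth_on D X ->
  smooth_on D Y -> smooth_on D (fun y => gamma g y (X y) (Y y)).
Proof.
move=> oD sg smg /smooth_mxP sX /smooth_mxP sY; apply/smooth_mxP => // z k.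
apply: (smooth_ext (f := fun y => \sum_(i < n) \sum_(j < n)
   christoffel g y k i j * X y 0 i * Y y 0 j)) => //.
  by move=> y _; rewrite mxE.
apply: smooth_sum => // i; apply: smooth_sum => // j.
have sd a b c : smooth_on D (fun y => 'D_(delta_mx 0 a) g y b c : R).
  by move/(smooth_derive (delta_mx 0 a))/smooth_mxP: smg; apply.
apply: smoothM => //; [apply: smoothM => // | exact: sY]; last exact: sX.
apply: smoothM => //; first exact: smooth_cst.
apply: smooth_sum => // l; apply: smoothM => //.
  have /smooth_mxP : smooth_on D (fun y => invmx (g y)).
    by apply: smooth_invmx => // y /sg /spd_unitmx.
  by apply.
by apply: smoothB => //; apply: smoothD.
Qed.

Lemma smooth_nabla D g X Y : open D ->
  (forall y, D y -> spd (g y)) -> smooth_on D g -> smooth_on D X ->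
  smooth_on D Y -> smooth_on D (nabla g X Y).
Proof.
move=> oD sg smg sX sY; apply: smoothD => //; last exact: smooth_gamma.
apply/smooth_mxP => // z j.
apply: (smooth_ext (f := fun y => \sum_a X y 0 a * 'D_(delta_mx 0 a) Y y z j)) => //.
  move=> y /set_mem Dy; rewrite (derive_sum_coord (X y) (smooth_diff sY Dy)).
  by rewrite summxE; apply: eq_bigr => a _; rewrite mxE.
apply: smooth_sum => // a; apply: smoothM => //.
  by move/smooth_mxP: sX; apply.
by move/(smooth_derive (delta_mx 0 a))/smooth_mxP: sY; apply.
Qed.

End Connection.

(** * The Gauss equation for a field of orthogonal projections *)

Section Gauss.
Context {R : realType} {n : nat}.
Context (D : set 'rV[R]_n) (g : 'rV[R]_n -> 'M[R]_n).
Context (oD : open D) (spdg : forall y, D y -> spd (g y)).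
Context (smg : smooth_on D g).

Lemma gammaBr x u v w : gamma g x u (v - w) = gamma g x u v - gamma g x u w.
Proof.
apply/rowP => k; rewrite !mxE -sumrB; apply: eq_bigr => i _.
by rewrite -sumrB; apply: eq_bigr => j _; rewrite !mxE mulrBr.
Qed.

Lemma nablaB X A B x : differentiable A x -> differentiable B x ->
  nabla g X (fun y => A y - B y) x = nabla g X A x - nabla g X B x.
Proof.
move=> dA dB; rewrite !nablaE gammaBr deriveB; try exact: diff_derivable.
by rewrite opprD addrACA.
Qed.

(** Metric compatibility for fields that stay orthogonal, as in the Weingarten
    identity. *)
Lemma nabla_orthogonal X A B x : D x ->
  differentiable A x -> differentiable B x ->
  (forall y, D y -> inner (g y) (A y) (B y) = 0) ->
  inner (g x) (nabla g X A x) (B x) = - inner (g x) (A x) (nabla g X B x).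
Proof.
move=> Dx dA dB AB; apply/eqP; rewrite -addr_eq0; apply/eqP.
have <- := derive_inner (X x) oD spdg Dx (smooth_diff smg Dx) dA dB.
transitivity ('D_(X x) (cst (0 : R)) x); last by rewrite derive_cst.
by apply: near_eq_derive; apply: open_near_eq oD _ Dx => y /set_mem /AB.
Qed.

Lemma lie_bracketE X Y x : D x ->
  nabla g X Y x - nabla g Y X x = lie_bracket X Y x.
Proof.
move=> Dx; rewrite !nablaE (gammaC (X x) _ oD spdg Dx (smooth_diff smg Dx)).
by rewrite opprD addrACA subrr addr0.
Qed.

(* The row space of P y is the distribution at y.  Vectors are rows, so P acts
   on the right; Q is the projection on the orthogonal complement. *)
Context (P : 'rV[R]_n -> 'M[R]_n) (smP : smooth_on D P).
Context (idemP : forall y, D y -> P y *m P y = P y).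
Context (adjP : forall y, D y -> forall u v,
  inner (g y) (u *m P y) v = inner (g y) u (v *m P y)).

Local Notation Q y := (1%:M - P y).
Local Notation proj_nabla := (fun X Y y => nabla g X Y y *m P y).

Lemma smooth_proj w : smooth_on D (fun y => w *m P y : 'rV[R]_n).
Proof. by apply: smooth_mulmx => //; exact: smooth_cst. Qed.

Lemma smooth_coproj : smooth_on D (fun y => Q y).
Proof. by apply: smoothB => //; exact: smooth_cst. Qed.

Lemma inner_QP y u v : D y -> inner (g y) (u *m Q y) (v *m P y) = 0.
Proof.
move=> Dy; rewrite -adjP // -mulmxA mulmxBl mul1mx idemP // subrr mulmx0.
exact: inner0l.
Qed.

Lemma inner_QQ y u v : D y ->
  inner (g y) (u *m Q y) v = inner (g y) (u *m Q y) (v *m Q y).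
Proof.
by move=> Dy; rewrite [v *m Q y]mulmxBr mulmx1 innerBr inner_QP // subr0.
Qed.

(** The terms with Q are the second fundamental forms of the distribution.
    The bracket [X, Y] enters both curvatures in the same way, so that they
    differ only through the iterated derivatives. *)
Lemma gauss X Y Z w x : D x -> w *m P x = w ->
  smooth_on D X -> smooth_on D Y -> smooth_on D Z ->
  inner (g x) (curvature proj_nabla X Y Z x) w =
  inner (g x) (curvature (nabla g) X Y Z x) w
  - inner (g x) (nabla g Y Z x *m Q x)
      (nabla g X (fun y => w *m P y) x *m Q x)
  + inner (g x) (nabla g X Z x *m Q x)
      (nabla g Y (fun y => w *m P y) x *m Q x).
Proof.
move=> Dx wP sX sY sZ; pose F y : 'rV[R]_n := w *m P y.
rewrite -[fun y => w *m P y]/F; have Fx : F x = w := wP; rewrite -Fx.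
have sF : smooth_on D F by exact: smooth_proj.
have step A B : smooth_on D A ->
    inner (g x) (nabla g B (proj_nabla A Z) x *m P x) (F x) =
    inner (g x) (nabla g B (nabla g A Z) x) (F x)
    + inner (g x) (nabla g A Z x *m Q x) (nabla g B F x *m Q x).
  move=> sA; have sN : smooth_on D (nabla g A Z) by apply: smooth_nabla.
  have sNQ : smooth_on D (fun y => nabla g A Z y *m Q y).
    by apply: smooth_mulmx => //; exact: smooth_coproj.
  rewrite adjP // -[F x *m P x]mulmxA idemP //.
  (* With N = nabla_A Z, the field N P differs from N by N Q, which is orthogonal
     to F, so that its derivative pairs with F through the derivative of F. *)
  have -> : (fun y => nabla g A Z y *m P y) = fun y => nabla g A Z y - nabla g A Z y *m Q y.
    by apply/funext => y; rewrite mulmxBr mulmx1 subKr.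
  rewrite nablaB; first last.
  - exact: smooth_diff Dx.
  - exact: smooth_diff Dx.
  rewrite innerBl -inner_QQ //; congr (_ + _).
  rewrite (@nabla_orthogonal B _ F) ?opprK //; first exact: smooth_diff Dx.
    exact: smooth_diff Dx.
  by move=> y Dy; exact: inner_QP.
have E1 := step Y X sY; have E2 := step X Y sX.
have E0 : inner (g x) (proj_nabla (lie_bracket X Y) Z x) (F x) =
    inner (g x) (nabla g (lie_bracket X Y) Z x) (F x).
  by rewrite adjP // -[F x *m P x]mulmxA idemP.
have curvE (N : ('rV[R]_n -> 'rV[R]_n) -> ('rV[R]_n -> 'rV[R]_n) -> 'rV[R]_n -> 'rV[R]_n) :
    inner (g x) (curvature N X Y Z x) (F x) =
    inner (g x) (N (lie_bracket X Y) Z x) (F x)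
    - inner (g x) (N X (N Y Z) x) (F x) + inner (g x) (N Y (N X Z) x) (F x).
  by rewrite /curvature innerDl innerBl.
rewrite !curvE E0.
have assemble (a b c d e b' c' : R) : b' = b + d -> c' = c + e ->
  a - b' + c' = a - b + c - d + e by move=> -> ->; ring.
exact: assemble E1 E2.
Qed.

(** A vector w in the distribution at x is extended by w Q, which vanishes at x;
    this kills the second summand of the O'Neill tensor. *)
Lemma proj_nabla_coproj0 w X x : D x -> w *m Q x = 0 ->
  nabla g X (fun y => w *m Q y) x *m P x = 0.
Proof.
move=> Dx wQ; apply: (inner_eq (spdg Dx)) => v; rewrite inner0l adjP //.
have sQ : smooth_on D (fun y => w *m Q y).
  by apply: smooth_mulmx => //; [exact: smooth_cst | exact: smooth_coproj].
rewrite (@nabla_orthogonal X _ (fun y => v *m P y)) //.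
- by rewrite wQ inner0l oppr0.
- exact: smooth_diff Dx.
- by apply: smooth_diff Dx; exact: smooth_proj.
- by move=> y Dy; exact: inner_QP.
Qed.

End Gauss.

(** * The vertical distribution of a submersion *)

Section KernelProjection.
Context {R : realType} {n l : nat}.
Implicit Types (G : 'M[R]_n) (A : 'M[R]_(n, l)).

Definition orth_kermx G A := kermx (G *m (kermx A)^T).

Lemma inner_kermx G A (u v : 'rV[R]_n) : (u <= orth_kermx G A)%MS ->
  (v <= kermx A)%MS -> inner G u v = 0.
Proof.
move=> /sub_kermxP uH /submxP[w ->].
by rewrite innerM trmx_mul !mulmxA -(mulmxA u) uH mul0mx mxE.
Qed.

Lemma kermx_cap0 G A : spd G -> (kermx A :&: orth_kermx G A = 0)%MS.
Proof.
move=> sG; apply/eqP/rowV0P => u; rewrite sub_capmx => /andP[uV uH].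
by apply/eqP; rewrite -(spd_inner_eq0 u sG) (inner_kermx uH uV).
Qed.

(** The Gram matrix of the differentials of the components of f, for the metric
    on covectors. *)
Definition gram G A : 'M[R]_l := A^T *m invmx G *m A.

(** If v is in the kernel of the Gram matrix, the vector v A^T G^-1 has norm 0. *)
Lemma gram_unitmx G A : spd G -> \rank A = l -> gram G A \in unitmx.
Proof.
move=> sG rA; rewrite -row_free_unit -kermx_eq0; apply/rowV0P => v.
move=> /sub_kermxP vS; have uG := spd_unitmx sG.
have At : row_free A^T by rewrite /row_free mxrank_tr rA.
apply/eqP; rewrite -(mulmx_free_eq0 v At).
have : v *m A^T *m invmx G == 0.
  rewrite -(spd_inner_eq0 _ sG) innerM mulmxKV //.
  rewrite trmx_mul trmx_inv sG.1 trmx_mul trmxK.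
  have -> : v *m A^T *m (invmx G *m (A *m v^T)) = v *m gram G A *m v^T.
    by rewrite /gram !mulmxA.
  by rewrite vS mul0mx mxE.
by move=> /eqP w0; rewrite -[v *m A^T](mulmxKV uG) w0 mul0mx.
Qed.

(** The closed formula shows that the projection depends smoothly on G and A,
    which the definition of [proj_mx] by Gaussian elimination does not. *)
Definition horiz_proj G A : 'M[R]_n :=
  A *m invmx (gram G A) *m (A^T *m invmx G).

Lemma horiz_proj_sub G A : spd G -> (horiz_proj G A <= orth_kermx G A)%MS.
Proof.
move=> sG; apply/sub_kermxP; rewrite /horiz_proj -!mulmxA.
rewrite (mulKmx (spd_unitmx sG)) -trmx_mul.
by rewrite mulmx_ker trmx0 !mulmx0.
Qed.

Lemma vert_proj_sub G A : spd G -> \rank A = l ->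
  (1%:M - horiz_proj G A <= kermx A)%MS.
Proof.
move=> sG rA; apply/sub_kermxP; rewrite mulmxBl mul1mx.
have -> : horiz_proj G A *m A = A *m (invmx (gram G A) *m gram G A).
  by rewrite /horiz_proj /gram !mulmxA.
by rewrite mulVmx ?gram_unitmx // mulmx1 subrr.
Qed.

Lemma proj_kermxE G A : spd G -> \rank A = l ->
  proj_mx (kermx A) (orth_kermx G A) = 1%:M - horiz_proj G A.
Proof.
move=> sG rA; rewrite -[LHS]mul1mx -{1}[1%:M](subrK (horiz_proj G A)) mulmxDl.
rewrite proj_mx_id ?vert_proj_sub ?kermx_cap0 //.
by rewrite proj_mx_0 ?horiz_proj_sub ?kermx_cap0 ?addr0.
Qed.

Lemma proj_orth_kermxE G A : spd G -> \rank A = l ->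
  proj_mx (orth_kermx G A) (kermx A) = horiz_proj G A.
Proof.
move=> sG rA; rewrite -[LHS]mul1mx -{1}[1%:M](subrK (horiz_proj G A)) mulmxDl.
have c0 : (orth_kermx G A :&: kermx A = 0)%MS by rewrite capmxC kermx_cap0.
by rewrite proj_mx_0 ?vert_proj_sub // add0r proj_mx_id ?horiz_proj_sub.
Qed.

Lemma proj_kermx_adj G A u v : spd G -> \rank A = l ->
  let P := 1%:M - horiz_proj G A in
  inner G (u *m P) v = inner G u (v *m P).
Proof.
move=> sG rA P.
have split (w : 'rV[R]_n) : w = w *m P + w *m horiz_proj G A by rewrite -mulmxDr subrK mulmx1.
have vs (w : 'rV[R]_n) : (w *m P <= kermx A)%MS by rewrite mulmx_sub ?vert_proj_sub.
have hs (w : 'rV[R]_n) : (w *m horiz_proj G A <= orth_kermx G A)%MS.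
  by rewrite mulmx_sub ?horiz_proj_sub.
rewrite {1}(split v) {2}(split u) innerDr innerDl (inner_kermx (hs u) (vs v)).
by rewrite (innerC (u *m P) (v *m horiz_proj G A) sG.1) (inner_kermx (hs v) (vs u)).
Qed.

End KernelProjection.

Section Submersion.
Context {R : realType} {n l : nat}.
Context (D : set 'rV[R]_n) (g : 'rV[R]_n -> 'M[R]_n) (f : 'rV[R]_n -> 'rV[R]_l).
Context (oD : open D) (spdg : forall y, D y -> spd (g y)).
Context (smg : smooth_on D g) (smf : smooth_on D f).
Context (rkf : forall y, D y -> \rank ('J f y) = l).

Definition vproj y := proj_mx (vert f y) (horiz g f y).
Local Notation P := vproj.
Local Notation Q y := (1%:M - P y).

Lemma vprojE y : D y -> P y = 1%:M - horiz_proj (g y) ('J f y).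
Proof. by move=> Dy; apply: proj_kermxE; [exact: spdg | exact: rkf]. Qed.

Lemma hprojE y : D y -> proj_mx (horiz g f y) (vert f y) = Q y.
Proof.
by move=> Dy; rewrite vprojE // subKr; apply: proj_orth_kermxE; [exact: spdg | exact: rkf].
Qed.

Lemma smooth_vproj : smooth_on D P.
Proof.
have sJ := smooth_jacobian oD smf; have sJT := smooth_trmx oD sJ.
have sgV : smooth_on D (fun y => invmx (g y)).
  by apply: smooth_invmx => // y /spdg /spd_unitmx.
apply: (smooth_ext (f := fun y => 1%:M - horiz_proj (g y) ('J f y))) => //.
  by move=> y /set_mem /vprojE.
apply: smoothB => //; first exact: smooth_cst.
apply: smooth_mulmx => //; last exact: smooth_mulmx.
apply: smooth_mulmx => //; apply: smooth_invmx => //.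
  by move=> y Dy; apply: gram_unitmx; [exact: spdg | exact: rkf].
by apply: smooth_mulmx => //; apply: smooth_mulmx.
Qed.

Lemma vproj_idem y : D y -> P y *m P y = P y.
Proof. by move=> /spdg sG; apply: proj_mx_proj; apply: kermx_cap0. Qed.

Lemma vproj_adj y : D y -> forall u v,
  inner (g y) (u *m P y) v = inner (g y) u (v *m P y).
Proof. by move=> Dy u v; rewrite vprojE // proj_kermx_adj; auto. Qed.

Lemma vproj_id y (u : 'rV[R]_n) : D y -> (u <= vert f y)%MS -> u *m P y = u.
Proof. by move=> /spdg sG; apply: proj_mx_id; apply: kermx_cap0. Qed.

(** Integrability of the vertical distribution.  Differentiating A J = 0, for a
    vertical field A, turns dA(u) J into minus the second derivative of f on u
    and A; the bracket is then an antisymmetrized second derivative. *)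
Lemma lie_bracket_vert X Y x : D x -> smooth_on D X -> smooth_on D Y ->
  (forall y, D y -> (X y <= vert f y)%MS) ->
  (forall y, D y -> (Y y <= vert f y)%MS) ->
  (lie_bracket X Y x <= vert f x)%MS.
Proof.
move=> Dx sX sY vX vY; apply/sub_kermxP; rewrite mulmxBl.
have sJ := smooth_jacobian oD smf.
have key A u : smooth_on D A -> (forall y, D y -> (A y <= vert f y)%MS) ->
    'D_u A x *m 'J f x = - 'D_u ('D_(A x) f) x.
  move=> sA vA; apply/eqP; rewrite -addr_eq0; apply/eqP.
  have -> : 'D_u ('D_(A x) f) x = A x *m 'D_u (fun y => 'J f y) x.
    transitivity ('D_u (fun y => A x *m 'J f y) x).
      apply: near_eq_derive; apply: open_near_eq oD _ Dx => y /set_mem Dy.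
      by rewrite deriveEjacobian //; apply: smooth_diff Dy.
    have := derive_mulmx u (differentiable_cst (A x) x) (smooth_diff sJ Dx).
    by rewrite derive_cst mul0mx add0r.
  rewrite -(derive_mulmx u (smooth_diff sA Dx) (smooth_diff sJ Dx)).
  transitivity ('D_u (cst (0 : 'rV[R]_l)) x); last by rewrite derive_cst.
  apply: near_eq_derive; apply: open_near_eq oD _ Dx => y /set_mem Dy.
  by apply/sub_kermxP; apply: vA.
rewrite (key Y (X x) sY vY) (key X (Y x) sX vX).
by rewrite (derive_comm (Y x) (X x) oD smf Dx) subrr.
Qed.

(** On vertical vectors the O'Neill tensor is the second fundamental form of the
    fibers; its other summand, the vertical part of the derivative of the
    horizontal part of v, vanishes. *)
Lemma oneill_TE x u v : D x -> (u <= vert f x)%MS -> (v <= vert f x)%MS ->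
  oneill_T g f x u v =
  nabla g (fun y => u *m P y) (fun y => v *m P y) x *m Q x.
Proof.
move=> Dx uV vV; rewrite /oneill_T {1}/hpart hprojE // -[RHS]addr0; congr (_ + _).
have vQ : v *m Q x = 0 by rewrite mulmxBr mulmx1 vproj_id // subrr.
have Ef y : D y -> hpart g f (fun=> v) y = v *m Q y by move=> Dy; rewrite /hpart hprojE.
rewrite /vpart.
have := proj_nabla_coproj0 oD spdg smg smooth_vproj vproj_idem vproj_adj
  (fun y => u *m P y) Dx vQ.
rewrite !nablaE (Ef x Dx).
suff -> : 'D_(u *m P x) (hpart g f (fun=> v)) x = 'D_(u *m P x) (fun y => v *m Q y) x by [].
by apply: near_eq_derive; apply: open_near_eq oD _ Dx => y /set_mem /Ef.
Qed.

(** The antisymmetric part of T is the horizontal part of a bracket of vertical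
    fields. *)
Lemma oneill_TC x u v : D x -> (u <= vert f x)%MS -> (v <= vert f x)%MS ->
  oneill_T g f x u v = oneill_T g f x v u.
Proof.
move=> Dx uV vV; rewrite !oneill_TE //; apply/eqP; rewrite -subr_eq0 -mulmxBl.
rewrite (lie_bracketE oD spdg smg) // mulmxBr mulmx1 vproj_id ?subrr //.
have sW w := smooth_proj oD smooth_vproj w.
have vW (w : 'rV[R]_n) y : D y -> (w *m P y <= vert f y)%MS.
  by move=> _; exact: proj_mx_sub.
exact: (lie_bracket_vert Dx (sW u) (sW v) (vW u) (vW v)).
Qed.

Lemma oneill_T_horiz x u v : D x -> (u <= vert f x)%MS -> (v <= vert f x)%MS ->
  (oneill_T g f x u v <= horiz g f x)%MS.
Proof. by move=> Dx uV vV; rewrite oneill_TE // -hprojE // proj_mx_sub. Qed.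

Lemma gauss_fiber x u v w z : D x ->
  (u <= vert f x)%MS -> (v <= vert f x)%MS -> (w <= vert f x)%MS ->
  (z <= vert f x)%MS ->
  inner (g x) (curvature_hat g f x u v w) z =
  inner (g x) (curvature (nabla g) (vpart g f (cst u)) (vpart g f (cst v))
     (vpart g f (cst w)) x) z
  - inner (g x) (oneill_T g f x v w) (oneill_T g f x u z)
  + inner (g x) (oneill_T g f x u w) (oneill_T g f x v z).
Proof.
move=> Dx uV vV wV zV; have sW a := smooth_proj oD smooth_vproj a.
rewrite (oneill_TE Dx vV wV) (oneill_TE Dx uV zV).
rewrite (oneill_TE Dx uV wV) (oneill_TE Dx vV zV).
exact: (gauss oD spdg smg smooth_vproj vproj_idem vproj_adj Dx
  (vproj_id Dx zV) (sW u) (sW v) (sW w)).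
Qed.

End Submersion.

(** * Curvature on a frame, and completing the square *)

Section Frames.
Context {R : realType} {n : nat}.
Implicit Types (G : 'M[R]_n).

Lemma inner_row G k (A : 'rV[R]_n) (X : 'M[R]_(k, n)) s :
  inner G A (row s X) = (A *m G *m X^T) 0 s.
Proof. by rewrite innerM tr_row mxE [RHS]mxE; apply: eq_bigr => k0 _; rewrite [in RHS]mxE !mxE. Qed.

Lemma inner_rows G p k (A : 'M[R]_(p, n)) (X : 'M[R]_(k, n)) a s :
  inner G (row a A) (row s X) = (A *m G *m X^T) a s.
Proof. by rewrite inner_row -!row_mul mxE. Qed.

Lemma parseval G k (X : 'M[R]_(k, n)) (A B : 'rV[R]_n) :
  X *m G *m X^T = 1%:M -> (A <= X)%MS -> (B <= X)%MS ->
  inner G A B = \sum_s inner G A (row s X) * inner G B (row s X).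
Proof.
move=> oX /submxP[a ->] /submxP[b ->].
have E (d : 'rV_k) s : inner G (d *m X) (row s X) = d 0 s.
  by rewrite inner_row -(mulmxA d X) -(mulmxA d) oX mulmx1.
have aXb : a *m X *m G *m (b *m X)^T = a *m (X *m G *m X^T) *m b^T.
  by rewrite trmx_mul !mulmxA.
rewrite innerM aXb oX mulmx1 mxE.
by apply: eq_bigr => s _; rewrite !E mxE.
Qed.

(** On vectors of a totally real subspace only the constant curvature part
    remains. *)
Lemma space_form_sectional c G (J : 'I_3 -> 'M[R]_n) (u v : 'rV[R]_n) :
  (forall a, inner G (v *m J a) v = 0) -> (forall a, inner G (u *m J a) v = 0) ->
  (forall a, inner G (v *m J a) u = 0) ->
  inner G (space_form_curvature c G J u v v) u =
  c / 4 * (inner G v v * inner G u u - inner G u v * inner G v u).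
Proof.
move=> Jvv Juv Jvu; rewrite /space_form_curvature.
rewrite big1 ?addr0 => [|a _]; first by rewrite innerZl innerBl !innerZl.
by rewrite Jvv Juv Jvu mulr0 !scale0r subrr addr0.
Qed.

End Frames.

Section Gap.
Context {R : realType} {r l : nat}.
Context (T : 'I_r -> 'I_r -> 'I_l -> R) (one : 'I_r).
Context (TC : forall a b s, T a b s = T b a s).

(** The contribution of X_s to the difference between the two sides of the
    inequality. *)
Definition gap s := 4^-1 * (T one one s - \sum_(a | a != one) T a a s) ^+ 2
  + \sum_(a | a != one) T one a s ^+ 2.

Lemma gapE s : gap s = 4^-1 * (\sum_a T a a s) ^+ 2
  - (\sum_a T a a s * T one one s) + \sum_a T one a s * T a one s.
Proof.
rewrite (bigD1 one) //= [in X in _ - X](bigD1 one) //= [in X in _ + X](bigD1 one) //=.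
rewrite -mulr_suml /gap.
have -> : \sum_(a | a != one) T one a s * T a one s = \sum_(a | a != one) T one a s ^+ 2.
  by apply: eq_bigr => a _; rewrite (TC a).
set S := \sum_(a | _) T a a s; set N := \sum_(a | _) _ ^+ 2.
by field.
Qed.

Lemma gap_ge0 s : 0 <= gap s.
Proof.
apply: addr_ge0; first by rewrite mulr_ge0 ?invr_ge0 ?sqr_ge0.
by apply: sumr_ge0 => a _; exact: sqr_ge0.
Qed.

Lemma gap_eq0 s : gap s = 0 <->
  T one one s = \sum_(a | a != one) T a a s /\
  forall b, b != one -> T one b s = 0.
Proof.
have N0 : 0 <= \sum_(a | a != one) T one a s ^+ 2.
  by apply: sumr_ge0 => a _; exact: sqr_ge0.
have A0 : 0 <= 4^-1 * (T one one s - \sum_(a | a != one) T a a s) ^+ 2.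
  by rewrite mulr_ge0 ?invr_ge0 ?sqr_ge0.
rewrite /gap; split=> [/eqP|[-> T0]].
  rewrite (paddr_eq0 A0 N0) => /andP[].
  rewrite mulf_eq0 invr_eq0 pnatr_eq0 /= sqrf_eq0 subr_eq0 => /eqP -> S0.
  split=> // b b1; apply/eqP; rewrite -sqrf_eq0; move: S0.
  rewrite psumr_eq0 => [/allP/(_ b)|a _]; last exact: sqr_ge0.
  by rewrite mem_index_enum b1 => /(_ isT).
rewrite subrr expr0n mulr0 add0r big1 // => b /T0 ->.
by rewrite expr0n.
Qed.

Lemma sum_gap_eq0 : \sum_s gap s = 0 <->
  forall s, T one one s = \sum_(a | a != one) T a a s /\
  forall b, b != one -> T one b s = 0.
Proof.
split=> [/eqP S0 s|g0]; last by apply: big1 => s _; apply/gap_eq0.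
apply/gap_eq0; apply/eqP; move: S0.
rewrite psumr_eq0 => [/allP/(_ s)|a _]; last exact: gap_ge0.
by rewrite mem_index_enum => /(_ isT).
Qed.

End Gap.

(** * The inequality *)

Lemma local_basis_subset (R : realType) (n : nat) (D : set 'rV[R]_n) g E
    (W W' : set 'rV[R]_n) J : open W' -> W' `<=` W ->
  local_basis D g E W J -> local_basis D g E W' J.
Proof.
move=> oW' sW [oW WD sJ hJ]; split=> //.
- by move=> y /sW /WD.
- by move=> a; apply: smooth_subset sW (sJ a).
- by move=> y /sW /hJ.
Qed.

(** The image of an open set is open because the inverse chart is continuous. *)
Lemma open_in_charts_dom (R : realType) (n l : nat) (M : smooth_manifold R n)
    (N : smooth_manifold R l) (phi : M -> N) (i : chart M) (j : chart N) :
  continuous phi ->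
  open (chart_coord i @` (chart_dom i `&` phi @^-1` chart_dom j)).
Proof.
move=> cphi; rewrite openE => y [q [qi qj] qy].
have yi : chart_image i y by exists q.
have py : chart_param i y = q by rewrite -qy coordK.
have oA : open (chart_dom i `&` phi @^-1` chart_dom j).
  apply: openI; first exact: dom_open.
  by move/continuousP: cphi; apply; exact: dom_open.
have /(param_continuous yi) nA : nbhs (chart_param i y)
    (chart_dom i `&` phi @^-1` chart_dom j).
  by rewrite py; exact: open_nbhs_nbhs.
have nI : nbhs y (chart_image i) by apply: open_nbhs_nbhs; split => //; exact: image_open.
rewrite /interior; apply: filterS2 nI nA => z [q' q'i <-] /=.
by rewrite coordK // => -[_ q'j]; exists q'.
Qed.

Theorem theorem3p5 (R : realType) (m l r : nat) (c : R)
    (M : smooth_manifold R (4 * m)%N) (gM : riemannian_metric M)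
    (E : almost_quaternionic_hermitian gM)
    (N : smooth_manifold R l) (gN : riemannian_metric N) (phi : M -> N)
    (hM : quaternionic_space_form E c)
    (hphi : riemannian_submersion gM gN phi)
    (hanti : anti_invariant E phi)
    (p : M) (i : chart M) (j : chart N)
    (hi : chart_dom i p) (hj : chart_dom j (phi p))
    (U : 'M[R]_(r, (4 * m)%N)) (X : 'M[R]_(l, (4 * m)%N)) (hr : (0 < r)%N) :
  let f := in_charts phi i j in
  let x := chart_coord i p in
  let g := gM i in
  U *m g x *m U^T = 1%:M ->
  X *m g x *m X^T = 1%:M ->
  U *m g x *m X^T = 0 ->
  (U :=: vert f x)%MS ->
  (X :=: horiz g f x)%MS ->
  let one : 'I_r := Ordinal hr in
  let T (a b : 'I_r) (s : 'I_l) : R :=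
    inner (g x) (oneill_T g f x (row a U) (row b U)) (row s X) in
  let H := mean_curvature g f x U in
  let ric := ricci_hat g f x U (row one U) in
  let bound := c / 4 * (r%:R - 1) - 4^-1 * r%:R ^+ 2 * inner (g x) H H in
  bound <= ric /\
  (ric = bound <->
   forall s : 'I_l,
     T one one s = \sum_(a < r | a != one) T a a s /\
     forall b : 'I_r, b != one -> T one b s = 0).
Proof.
move=> f x g UU XX _ Uvert Xhoriz one T H ric bound.
have [_ [cphi smphi] _ sub] := hphi.
(* The local basis of the bundle is restricted to the domain of f, where the
   vertical fields are smooth. *)
pose D0 := chart_coord i @` (chart_dom i `&` phi @^-1` chart_dom j).
have oD0 : open D0 by exact: open_in_charts_dom.
have [W0 [J [W0x loc0]]] : exists W J, W x /\ local_basis (chart_image i) g (E i) W J.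
  by apply: bundle_basis; exists p.
pose W := W0 `&` D0.
have D0x : D0 x by exists p.
have Wx : W x by [].
have oW : open W by apply: openI => //; have [] := loc0.
have loc : local_basis (chart_image i) g (E i) W J.
  by apply: local_basis_subset loc0 => // y [].
have WI y : W y -> chart_image i y by have [_ WI _ _] := loc; exact: WI.
have spdg y : W y -> spd (g y).
  move=> /WI yi; split; first exact: (Defs.metric_sym gM yi).
  by move=> u; exact: (metric_pos gM yi).
have smg : smooth_on W g by apply: smooth_subset WI (metric_smooth gM i).
have smf : smooth_on W f by apply: smooth_subset (smphi i j) => y [].
have rkf y : W y -> \rank ('J f y) = l.
  by move=> [_ [q [qi qj] <-]]; have [] := sub i j q qi qj.
have UV a : (row a U <= vert f x)%MS by rewrite -Uvert row_sub.
have UUE a b : inner (g x) (row a U) (row b U) = (a == b)%:R.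
  by rewrite inner_rows UU mxE.
have Thoriz a b : (oneill_T g f x (row a U) (row b U) <= X)%MS.
  by rewrite Xhoriz; apply: (oneill_T_horiz oW spdg smg smf rkf).
have TC a b s : T a b s = T b a s.
  by rewrite /T (oneill_TC oW spdg smg smf rkf Wx (UV a) (UV b)).
have JU a b d : inner (g x) (row a U *m J d x) (row b U) = 0.
  apply: (inner_kermx _ (UV b)).
  apply: submx_trans (hanti i j p hi hj W J loc Wx d).
  exact: submxMr.
(* The a = one term is kept: its space form part vanishes, and its two O'Neill
   terms cancel. *)
have curvU a : inner (g x) (curvature_hat g f x (row one U) (row a U) (row a U)) (row one U)
    = c / 4 * (1 - (a == one)%:R) - \sum_s T a a s * T one one s
      + \sum_s T one a s * T a one s.
  rewrite (gauss_fiber oW spdg smg smf rkf Wx (UV one) (UV a) (UV a) (UV one)).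
  rewrite (parseval XX (Thoriz a a) (Thoriz one one)).
  rewrite (parseval XX (Thoriz one a) (Thoriz a one)).
  congr (_ - _ + _).
  have sV w := smooth_proj oW (smooth_vproj oW spdg smg smf rkf) w.
  have vid b : vpart g f (cst (row b U)) x = row b U.
    exact: (vproj_id spdg Wx (UV b)).
  have K : curvature (nabla g) (vpart g f (cst (row one U)))
      (vpart g f (cst (row a U))) (vpart g f (cst (row a U))) x =
      space_form_curvature c (g x) (J ^~ x) (vpart g f (cst (row one U)) x)
        (vpart g f (cst (row a U)) x) (vpart g f (cst (row a U)) x).
    exact: (hM.2 i W J loc _ _ _ x (sV _) (sV _) (sV _) Wx).
  rewrite (vid one) (vid a) in K; rewrite K space_form_sectional // !UUE eqxx.
  by rewrite (eq_sym one) eqxx mulr1; case: (a == one); rewrite ?mulr0 ?mulr1.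
have r0 : r%:R != 0 :> R by rewrite pnatr_eq0 -lt0n.
have ricE : ric = c / 4 * (r%:R - 1) - \sum_s \sum_a T a a s * T one one s
    + \sum_s \sum_a T one a s * T a one s.
  rewrite /ric /ricci_hat (eq_bigr _ (fun a _ => curvU a)) big_split /= sumrB.
  rewrite exchange_big [in X in _ + X]exchange_big; congr (_ - _ + _).
  rewrite -mulr_sumr sumrB sumr_const card_ord; congr (_ * (_ - _)).
  rewrite (bigD1 one) // eqxx big1; first exact: addr0.
  by move=> a /negPf ->.
have HE : r%:R ^+ 2 * inner (g x) H H = \sum_s (\sum_a T a a s) ^+ 2.
  pose S := \sum_a oneill_T g f x (row a U) (row a U).
  have SX : (S <= X)%MS by apply: summx_sub => a _; exact: Thoriz.
  have -> : inner (g x) H H = r%:R^-1 * (r%:R^-1 * inner (g x) S S).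
    by rewrite /H /mean_curvature innerZl (innerC _ _ (spdg x Wx).1) innerZl.
  rewrite expr2 -mulrA mulVKf // mulVKf // (parseval XX SX SX).
  by apply: eq_bigr => s _; rewrite /S inner_suml expr2.
have gapsum : ric - bound = \sum_s gap T one s.
  rewrite (eq_bigr _ (fun s _ => gapE one TC s)) big_split /= sumrB -mulr_sumr.
  rewrite ricE /bound -[4^-1 * _ * _]mulrA HE.
  set A := \sum_s _; set B := \sum_s _; set S := \sum_s _; set k := c / 4 * _.
  ring.
split; first by rewrite -subr_ge0 gapsum; apply: sumr_ge0 => s _; exact: gap_ge0.
rewrite -(sum_gap_eq0 T one) -gapsum.
by split=> [->|/eqP]; [rewrite subrr | rewrite subr_eq0 => /eqP].
Qed.
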